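(* Let $n\ge1$ and $d\ge2$ with $n$ or $d$ odd. Let $s_2,\dots,s_d\in\{1,\dots,n-1\}$ with $\gcd(s_i,n)=1$ for all $i$, and let $\pi^2_n,\dots,\pi^d_n\in\{0,\dots,n-1\}$. For $2\le i\le d$ and $1\le j\le n$ let $\pi^i_j\in\{0,\dots,n-1\}$ be defined by $\pi^i_j\equiv\pi^i_n+j\,s_i \pmod n$. Then $\Pi=(\pi^2,\dots,\pi^d)$, with $\pi^i=\pi^i_1\cdots\pi^i_n$, belongs to $S^d_n$. Moreover, let $d=4$ and $n=2k+1$ with $k\ge1$, and suppose $s_2=1$ and $\pi^2_n=n-1$. Then: (a) if $s_3=1$, then $\Pi\in M_{4,n}$ if and only if $s_4=n-2$ and $(\pi^3_n,\pi^4_n)\in\{(k-1,1),(k,0)\}$; (b) if $s_3=k$, then $\Pi\in M_{4,n}$ if and only if $s_4=k$ and $(\pi^3_n,\pi^4_n)\in\{(0,k),(k,0)\}$.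
   Context: $S_n$ is the set of permutations of $\{0,\dots,n-1\}$ in one-line notation. $S^d_n$ is the set of $(d-1)$-tuples $\Pi=(\pi^2,\dots,\pi^d)$ of elements of $S_n$, with elements (columns) $\Pi_j=(\pi^2_j,\dots,\pi^d_j)^T$. The (sum) level is $\mathrm{lev}(\Pi_j)=\pi^2_j+\dots+\pi^d_j$ and $\mathrm{lev}_{\max}(\Pi)=\max_j\mathrm{lev}(\Pi_j)$. Let $m_{d,n}=\min\{\mathrm{lev}_{\max}(\Pi):\Pi\in S^d_n\}$ and $M_{d,n}=\{\Pi\in S^d_n:\mathrm{lev}_{\max}(\Pi)=m_{d,n}\}$ (minimal permutations). *)

(* Defs.v *)
From mathcomp Require Import all_boot all_fingroup.

Set Implicit Arguments.
Unset Strict Implicit.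
Unset Printing Implicit Defensive.

(* A word of length n over {0, ..., n-1}: the letter written w_j (1 <= j <= n)
   on paper is w (j - 1) here, since 'I_n starts at 0. *)
Definition word (n : nat) := {ffun 'I_n -> 'I_n}.

Definition one_line n (s : 'S_n) : word n := [ffun j => s j].

Definition perm_words n : {set word n} := [set one_line s | s : 'S_n].

(* (d-1)-tuples of words; the component written pi^i (2 <= i <= d) on paper is
   P (i - 2) here. *)
Definition words (d n : nat) := {ffun 'I_d.-1 -> word n}.

Definition Sdn d n : {set words d n} :=
  [set P : words d n | [forall i, P i \in perm_words n]].

Definition lev d n (P : words d n) (j : 'I_n) : nat :=
  \sum_(i < d.-1) P i j.

Definition levmax d n (P : words d n) : nat := \max_(j < n) lev P j.

Definition id_words d n : words d n := [ffun=> [ffun j => j]].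

Lemma id_words_Sdn d n : id_words d n \in Sdn d n.
Proof.
rewrite inE; apply/forallP => i; apply/imsetP; exists 1%g; rewrite ?inE //.
by apply/ffunP => j; rewrite !ffunE perm1.
Qed.

Definition mdn d n : nat :=
  levmax [arg min_(P < id_words d n in Sdn d n) levmax P].

Lemma mdn_attained d n : exists2 P, P \in Sdn d n & levmax P = mdn d n.
Proof.
rewrite /mdn; case: arg_minnP => [|P SP _]; first exact: id_words_Sdn.
by exists P.
Qed.

Lemma mdn_le d n (P : words d n) : P \in Sdn d n -> mdn d n <= levmax P.
Proof.
rewrite /mdn; case: arg_minnP => [|Q _ minQ]; first exact: id_words_Sdn.
exact: minQ.
Qed.

Definition Mdn d n : {set words d n} :=
  [set P in Sdn d n | levmax P == mdn d n].

(* Main.v *)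
(* The levels of an element of S^4_n, n = 2k+1, have average 3k, and the
   progressions with steps 1, k, k ending in n-1, 0, k have constant level 3k;
   so m_{4,n} = 3k and the minimal permutations are those of constant level 3k.
   The last column then gives pi^3_n + pi^4_n = k, the first one gives
   s_2 + s_3 + s_4 = n, and the first (s_3 = 1) or second (s_3 = k) column
   leaves only the listed end values. *)
Require Import Defs.
From mathcomp Require Import all_boot all_fingroup zify.

Set Implicit Arguments.
Unset Strict Implicit.
Unset Printing Implicit Defensive.

Lemma modn_eq q n m r : m = q * n + r -> r < n -> m %% n = r.
Proof. by move=> -> r_lt; rewrite modnMDl modn_small. Qed.

(** Equal letters at positions [i <= j] make [n] divide [(j - i) * b], hence [j - i] by coprimality,
    so the word is injective. *)
Lemma progression_perm_word n (w : word n) a b :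
    coprime b n -> (forall j : 'I_n, w j = a + j.+1 * b %[mod n]) ->
  w \in perm_words n.
Proof.
move=> co_bn w_mod.
have le_inj (i j : 'I_n) : i <= j -> w i = w j -> i = j.
  move=> le_ij eq_w; have : a + j.+1 * b == a + i.+1 * b %[mod n].
    by rewrite -!w_mod eq_w.
  rewrite eqn_modDl eqn_mod_dvd ?leq_mul // -mulnBl subSS Gauss_dvdl; last first.
    by rewrite coprime_sym.
  by rewrite -eqn_mod_dvd // !modn_small // => /eqP/esym/val_inj.
have w_inj : injective w.
  move=> i j eq_w; have [le_ij|/ltnW le_ji] := leqP i j; first exact: le_inj.
  exact/esym/le_inj.
apply/imsetP; exists (perm w_inj); rewrite ?inE //.
by apply/ffunP => j; rewrite ffunE permE.
Qed.

Lemma sum_lev d n (P : words d n) :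
  P \in Sdn d n -> \sum_(j < n) lev P j = d.-1 * 'C(n, 2).
Proof.
rewrite inE => /forallP permP.
rewrite exchange_big -[d.-1 in RHS]card_ord -sum_nat_const.
apply: eq_bigr => i _; have /imsetP[u _ ->] := permP i.
rewrite -bin2_sum big_mkord [RHS](reindex_inj (@perm_inj _ u)).
by apply: eq_bigr => j _; rewrite ffunE.
Qed.

Lemma sum_lev4 k (P : words 4 (2 * k + 1)) :
  P \in Sdn 4 (2 * k + 1) ->
  \sum_(j < 2 * k + 1) lev P j = (2 * k + 1) * (3 * k).
Proof.
move/sum_lev->; rewrite bin2 (_ : _ * _.-1 = ((2 * k + 1) * k).*2) ?doubleK; lia.
Qed.

(** The average level is [3 * k], so levels bounded by [3 * k] must all equal it: the equality case
    of a sum of inequalities. *)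
Lemma lev_const_levmax k (P : words 4 (2 * k + 1)) :
  P \in Sdn 4 (2 * k + 1) ->
  levmax P <= 3 * k <-> (forall j, lev P j = 3 * k).
Proof.
move=> SP; split=> [/bigmax_leqP lev_le j|lev_eq]; last first.
  by apply/bigmax_leqP => j _; rewrite lev_eq.
apply/eqP.
have le_lev i : true -> lev P i <= 3 * k ?= iff (lev P i == 3 * k).
  by move=> _; split=> //; apply: lev_le.
have [_] := leqif_sum le_lev.
by rewrite sum_lev4 // sum_nat_const card_ord eqxx => /esym/forallP/(_ j).
Qed.

Lemma levmax4_ge k (P : words 4 (2 * k + 1)) :
  P \in Sdn 4 (2 * k + 1) -> 3 * k <= levmax P.
Proof.
move=> SP; suff : (2 * k + 1) * (3 * k) <= (2 * k + 1) * levmax P.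
  by rewrite leq_pmul2l // addn1.
rewrite -(sum_lev4 SP) -[X in _ <= X * _]card_ord -sum_nat_const.
by apply: leq_sum => j _; apply: leq_bigmax.
Qed.

(* The level of the column Pi_j, for 1 <= j <= n, when s_2 = 1 and
   pi^2_n = n - 1. *)
Definition column_sum (n s3 p3 s4 p4 j : nat) : nat :=
  j.-1 + (p3 + j * s3) %% n + (p4 + j * s4) %% n.

Lemma lev_progression n (s p : nat -> nat) (P : words 4 n) (j : 'I_n) :
    (forall (i : 'I_3) (j : 'I_n), P i j = p i.+2 + j.+1 * s i.+2 %[mod n]) ->
    s 2 = 1 -> p 2 = n - 1 ->
  lev P j = column_sum n (s 3) (p 3) (s 4) (p 4) j.+1.
Proof.
move=> P_mod s2 p2; have val_P i : P i j = (p i.+2 + j.+1 * s i.+2) %% n :> nat.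
  by rewrite -P_mod modn_small.
rewrite /lev !big_ord_recl big_ord0 !val_P /= /column_sum s2 p2 addn0 addnA.
(* The first word reads 0, 1, ..., n-1, since (n - 1) + (j + 1) = n + j. *)
congr (_ + _ + _); apply: (@modn_eq 1) => //; have := ltn_ord j; lia.
Qed.

(** In case (b) both steps are [k], so the end values (k, 0) reduce to (0, k). *)
Lemma column_sum_swap n s3 p3 s4 p4 j :
  column_sum n s3 p3 s4 p4 j = column_sum n s4 p4 s3 p3 j.
Proof. by rewrite /column_sum -!addnA [X in _ + X]addnC. Qed.

(** Modulo n the steps are 1, 1, -2, with sum 0. Just after column [k + b] the second summand drops
    by an extra n while the third gains n, so the level is unaffected. *)
Lemma column_sum_const_a k b j : b <= 1 -> b <= k -> 1 <= j <= 2 * k + 1 ->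
  column_sum (2 * k + 1) 1 (k - b) (2 * k - 1) b j = 3 * k.
Proof.
move=> b1 bk /andP[j1 jn]; rewrite /column_sum.
have [jk|kj] := leqP j (k + b).
- have -> : (k - b + j * 1) %% (2 * k + 1) = k - b + j.
    by apply: (@modn_eq 0); lia.
  have -> : (b + j * (2 * k - 1)) %% (2 * k + 1) = 2 * k + 1 + b - 2 * j.
    by apply: (@modn_eq j.-1); nia.
  lia.
- have -> : (k - b + j * 1) %% (2 * k + 1) = j - (k + b).+1.
    by apply: (@modn_eq 1); lia.
  have -> : (b + j * (2 * k - 1)) %% (2 * k + 1) = 2 * (2 * k + 1) + b - 2 * j.
    by apply: (@modn_eq j.-2); nia.
  lia.
Qed.

Lemma column_sum_const_b k j : 1 <= j <= 2 * k + 1 ->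
  column_sum (2 * k + 1) k 0 k k j = 3 * k.
Proof.
move=> /andP[j1 jn]; rewrite /column_sum.
(* As 2k is -1 modulo n, j k is congruent to k - i for j = 2i + 1 and to -(i + 1) for j = 2(i +
   1). *)
have [i [j_eq|j_eq]] : exists i, j = 2 * i + 1 \/ j = 2 * i.+1.
  by exists j.-1./2; lia.
- have -> : (0 + j * k) %% (2 * k + 1) = k - i by apply: (@modn_eq i); nia.
  have -> : (k + j * k) %% (2 * k + 1) = 2 * k - i by apply: (@modn_eq i); nia.
  lia.
- have -> : (0 + j * k) %% (2 * k + 1) = 2 * k - i by apply: (@modn_eq i); nia.
  have -> : (k + j * k) %% (2 * k + 1) = k - i.+1.
    by apply: (@modn_eq i.+1); nia.
  lia.
Qed.

(** The bound [s3 <= k] covers both s_3 = 1 and s_3 = k; with [p3 <= k] it keeps [p3 + s3] below n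
    in column 1. *)
Lemma column_sum_const_inv k s3 p3 s4 p4 : 1 <= k ->
    (forall j, 1 <= j <= 2 * k + 1 ->
       column_sum (2 * k + 1) s3 p3 s4 p4 j = 3 * k) ->
    s3 <= k -> 1 <= s4 <= 2 * k -> p3 <= 2 * k -> p4 <= 2 * k ->
  s4 = 2 * k - s3 /\ p3 + p4 = k.
Proof.
move=> k1 const s3_le s4_bd p3_le p4_le.
have := const (2 * k + 1) ltac:(lia).
rewrite /column_sum ![_ + (2 * k + 1) * _]addnC ![(2 * k + 1) * _]mulnC.
rewrite !modnMDl !modn_small; [|lia..] => last_col.
have p34 : p3 + p4 = k by lia.
split=> //; have := const 1 ltac:(lia).
rewrite /column_sum !mul1n modn_small; last lia.
(* If [p4 + s4] reached n, the level of column 1 would be k + s3 + s4 - n, which is below 3k. *)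
have [small|large] := ltnP (p4 + s4) (2 * k + 1).
  by rewrite modn_small //; lia.
rewrite (@modn_eq 1 _ _ (p4 + s4 - (2 * k + 1))); lia.
Qed.

(** For [p4 >= 2] the last summand wraps around to [p4 - 2], and column 1 has level only k - 1. *)
Lemma column_sum_const_inv_a k p3 p4 : 1 <= k -> p3 + p4 = k ->
    column_sum (2 * k + 1) 1 p3 (2 * k - 1) p4 1 = 3 * k ->
  p4 <= 1.
Proof.
move=> k1 p34; rewrite /column_sum; case: leqP => // p4_ge2.
rewrite (@modn_eq 0 _ _ (p3 + 1)) ?(@modn_eq 1 _ _ (p4 - 2)); lia.
Qed.

(** Column 1 has level 3k for every such pair. In column 2 both words have moved by 2k, that is -1
    modulo n; if both end values are positive, the level is 1 + (k - 2). *)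
Lemma column_sum_const_inv_b k p3 p4 : 1 <= k -> p3 + p4 = k ->
    column_sum (2 * k + 1) k p3 k p4 2 = 3 * k ->
  p3 = 0 \/ p4 = 0.
Proof.
move=> k1 p34; rewrite /column_sum.
have [->|p3_gt0] := posnP p3; first by left.
have [->|p4_gt0] := posnP p4; first by right.
rewrite (@modn_eq 1 _ _ (p3 - 1)) ?(@modn_eq 1 _ _ (p4 - 1)); lia.
Qed.

Definition progressions d n (s p : nat -> nat) (n_gt0 : 0 < n) : words d n :=
  [ffun i : 'I_d.-1 => [ffun j : 'I_n =>
    Ordinal (ltn_pmod (p i.+2 + j.+1 * s i.+2) n_gt0)]].

Lemma mdn4 k : 1 <= k -> mdn 4 (2 * k + 1) = 3 * k.
Proof.
move=> k1; apply/eqP; rewrite eqn_leq; apply/andP; split; last first.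
  by have [P SP <-] := mdn_attained 4 (2 * k + 1); apply: levmax4_ge.
have n_gt0 : 0 < 2 * k + 1 by lia.
pose s i := if i == 2 then 1 else k.
pose p i := if i == 2 then 2 * k + 1 - 1 else if i == 3 then 0 else k.
have P_mod (i : 'I_3) (j : 'I_(2 * k + 1)) :
    progressions 4 s p n_gt0 i j = p i.+2 + j.+1 * s i.+2 %[mod 2 * k + 1].
  by rewrite !ffunE /= modn_mod.
have SP : progressions 4 s p n_gt0 \in Sdn 4 (2 * k + 1).
  rewrite inE; apply/forallP => i; apply: (progression_perm_word _ (P_mod i)).
  rewrite /s; case: ifP => _; first exact: coprime1n.
  by rewrite /coprime gcdnMDl gcdn1.
apply: leq_trans (mdn_le SP) _; apply/lev_const_levmax => // j.
rewrite (lev_progression _ P_mod) // /s /p /=.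
by apply: column_sum_const_b; have := ltn_ord j; lia.
Qed.

Lemma Mdn4P k (P : words 4 (2 * k + 1)) : 1 <= k ->
  P \in Sdn 4 (2 * k + 1) ->
  P \in Mdn 4 (2 * k + 1) <-> (forall j, lev P j = 3 * k).
Proof.
move=> k1 SP; rewrite inE SP mdn4 // eqn_leq levmax4_ge // andbT.
exact: lev_const_levmax.
Qed.

(* s i and p i stand for s_i and pi^i_n, for 2 <= i <= d; other values of the
   index are irrelevant. *)
Theorem theorem4p4 (n d : nat) (s p : nat -> nat) (Pi : words d n)
    (hn : 1 <= n) (hd : 2 <= d) (hodd : odd n || odd d)
    (hs : forall i : nat, 2 <= i <= d -> 1 <= s i <= n - 1)
    (hgcd : forall i : nat, 2 <= i <= d -> gcdn (s i) n = 1)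
    (hp : forall i : nat, 2 <= i <= d -> p i <= n - 1)
    (hPi : forall (i : 'I_d.-1) (j : 'I_n),
        Pi i j = p i.+2 + j.+1 * s i.+2 %[mod n]) :
  Pi \in Sdn d n /\
  (forall k : nat, d = 4 -> n = 2 * k + 1 -> 1 <= k ->
     s 2 = 1 -> p 2 = n - 1 ->
     (s 3 = 1 ->
        (Pi \in Mdn d n <->
           s 4 = n - 2 /\
           ((p 3, p 4) = (k - 1, 1) \/ (p 3, p 4) = (k, 0)))) /\
     (s 3 = k ->
        (Pi \in Mdn d n <->
           s 4 = k /\
           ((p 3, p 4) = (0, k) \/ (p 3, p 4) = (k, 0))))).
Proof.
have SP : Pi \in Sdn d n.
  rewrite inE; apply/forallP => i; apply: (progression_perm_word _ (hPi i)).
  by rewrite /coprime hgcd //; have := ltn_ord i; lia.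
split=> // k d4 nk k1 s2 p2; subst d n.
(* Minimality is restated with columns numbered from 1 to n instead of by ordinals. *)
have const_lev : Pi \in Mdn 4 (2 * k + 1) <->
    (forall j, 1 <= j <= 2 * k + 1 ->
       column_sum (2 * k + 1) (s 3) (p 3) (s 4) (p 4) j = 3 * k).
  rewrite Mdn4P //; split=> const j.
    case: j => // j /= j_lt.
    by rewrite -(lev_progression (Ordinal j_lt) hPi s2 p2).
  rewrite (lev_progression _ hPi) // const //.
  by have := ltn_ord j; lia.
have s4_bd := hs 4 isT; have p3_le := hp 3 isT; have p4_le := hp 4 isT.
split=> s3; rewrite const_lev s3; split.
- move=> const.
  have [||||s4 p34] := column_sum_const_inv k1 const; [lia..|].
  split; first lia.
  have := const 1 ltac:(lia); rewrite s4 => /(column_sum_const_inv_a k1 p34) p4_le1.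
  have [p4_eq0|p4_eq1] : p 4 = 0 \/ p 4 = 1 by lia.
    by right; congr (_, _); lia.
  by left; congr (_, _); lia.
- case=> -> p34 j j_bd; rewrite (_ : _ - 2 = 2 * k - 1); last lia.
  (* Both listed pairs have the form (k - b, b) with b = [p 4]. *)
  have [p4_le1 ->] : p 4 <= 1 /\ p 3 = k - p 4.
    by case: p34 => -[-> ->]; rewrite ?subn0.
  by apply: column_sum_const_a => //; lia.
- move=> const; have [||||s4 p34] := column_sum_const_inv k1 const; [lia..|].
  have s4k : s 4 = k by lia.
  split=> //; have := const 2 ltac:(lia).
  rewrite s4k => /(column_sum_const_inv_b k1 p34).
  by case=> p_eq0; [left|right]; rewrite p_eq0; congr (_, _); lia.
- case=> -> [] [-> ->] j j_bd; last rewrite column_sum_swap.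
    exact: column_sum_const_b.
  exact: column_sum_const_b.
Qed.
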